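(* (Burnside Theorem.) Let $\mathcal{G}$ be a locally strongly finite groupoid. Let $(X,\varsigma)$ and $(Y,\vartheta)$ be two finite right $\mathcal{G}$-sets. Then the following statements are equivalent: (1) The right $\mathcal{G}$-sets $(X,\varsigma)$ and $(Y,\vartheta)$ are isomorphic. (2) For each subgroupoid $\mathcal{H}$ of $\mathcal{G}$ with a single object, we have $|X^{\mathcal{H}}|=|Y^{\mathcal{H}}|$. In particular, this applies to any strongly finite groupoid.
   Context: A groupoid $\mathcal{G}=(\mathcal{G}_1,\mathcal{G}_0)$ is a small category in which every morphism is invertible; $\mathsf{s},\mathsf{t}$ denote source and target, $\iota_x$ the identity arrow of $x$; $gh$ is defined when $\mathsf{s}(g)=\mathsf{t}(h)$; $\mathcal{G}(x,y)$ is the set of arrows from $x$ to $y$, and $\mathcal{G}^x=\mathcal{G}(x,x)$ is the isotropy group at $x$. A subgroupoid is a non-empty subcategory stable under inverses; a subgroupoid $\mathcal{H}$ with a single object $a$ is the same thing as a subgroup $\mathcal{H}_1\le\mathcal{G}^a$. A right $\mathcal{G}$-set $(X,\varsigma)$ is a set $X$ with a map $\varsigma:X\to\mathcal{G}_0$ and an action $(x,g)\mapsto xg$, defined when $\varsigma(x)=\mathsf{t}(g)$, such that $\varsigma(xg)=\mathsf{s}(g)$, $x\,\iota_{\varsigma(x)}=x$, $(xg)h=x(gh)$ whenever defined. It is finite if $X$ is a finite set. Morphisms are maps commuting with structure maps and actions. For a subgroupoid $\mathcal{H}$ with single object $a$, the set of fixed points is $X^{\mathcal{H}}=\{x\in X\mid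 \varsigma(x)=a \text{ and } xh=x \text{ for all } h\in\mathcal{H}_1\}$. $\mathcal{S}_{\mathcal{G}}$ is the set of all subgroupoids of $\mathcal{G}$ with exactly one object, and $\sim_{C}$ is the conjugation equivalence relation on it: $\mathcal{H}$ (object $a$) and $\mathcal{K}$ (object $b$) are conjugated iff there is $d\in\mathcal{G}(a,b)$ with $\mathcal{K}_1=d\mathcal{H}_1d^{-1}$. $\mathcal{G}$ is strongly finite if $\mathcal{G}_1$ is finite. $\mathcal{G}$ is locally strongly finite if $\mathcal{S}_{\mathcal{G}}/\sim_C$ is a finite set and every isotropy group of $\mathcal{G}$ is finite. *)

(* Defs.v *)
From mathcomp Require Import all_boot.
From mathcomp Require Import boolp classical_sets functions cardinality.

Set Implicit Arguments.
Unset Strict Implicit.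
Unset Printing Implicit Defensive.

Local Open Scope classical_set_scope.
Local Open Scope card_scope.

(* Composition is a total function whose values on non-composable pairs are
   arbitrary: every axiom and every later definition only looks at
   [gcomp g h] when [src g = tgt h]. *)
Record groupoid := Groupoid {
  obj : Type;
  arr : Type;
  src : arr -> obj;
  tgt : arr -> obj;
  gid : obj -> arr;
  gcomp : arr -> arr -> arr;
  ginv : arr -> arr;
  src_gid : forall x, src (gid x) = x;
  tgt_gid : forall x, tgt (gid x) = x;
  src_gcomp : forall g h, src g = tgt h -> src (gcomp g h) = src h;
  tgt_gcomp : forall g h, src g = tgt h -> tgt (gcomp g h) = tgt g;
  gcompA : forall f g h, src f = tgt g -> src g = tgt h ->
    gcomp f (gcomp g h) = gcomp (gcomp f g) h;
  gcomp1g : forall g, gcomp (gid (tgt g)) g = g;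
  gcompg1 : forall g, gcomp g (gid (src g)) = g;
  src_ginv : forall g, src (ginv g) = tgt g;
  tgt_ginv : forall g, tgt (ginv g) = src g;
  gcompVg : forall g, gcomp (ginv g) g = gid (src g);
  gcompgV : forall g, gcomp g (ginv g) = gid (tgt g)
}.

Definition hom (G : groupoid) (x y : obj G) : set (arr G) :=
  [set g | src g = x /\ tgt g = y].

Definition isotropy (G : groupoid) (x : obj G) : set (arr G) := hom x x.

Record subgroupoid (G : groupoid) := Subgroupoid {
  sobj : set (obj G);
  sarr : set (arr G);
  sobj_nonempty : sobj !=set0;
  sarr_src : forall g, sarr g -> sobj (src g);
  sarr_tgt : forall g, sarr g -> sobj (tgt g);
  sarr_gid : forall x, sobj x -> sarr (gid x);
  sarr_gcomp : forall g h, sarr g -> sarr h -> src g = tgt h ->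
    sarr (gcomp g h);
  sarr_ginv : forall g, sarr g -> sarr (ginv g)
}.

Definition has_single_object (G : groupoid) (H : subgroupoid G) (a : obj G) :=
  sobj H = [set a].

Definition single_object_subgroupoids (G : groupoid) : set (subgroupoid G) :=
  [set H | exists a, has_single_object H a].
Arguments single_object_subgroupoids : clear implicits.

Definition conjugated (G : groupoid) (H K : subgroupoid G) : Prop :=
  exists a b d, [/\ has_single_object H a, has_single_object K b,
    hom a b d & sarr K = [set gcomp (gcomp d h) (ginv d) | h in sarr H]].

(* The quotient of the single-object subgroupoids by conjugation, as the set of
   equivalence classes; [conjugated H K] forces K to have a single object. *)
Definition conjugacy_classes (G : groupoid) : set (set (subgroupoid G)) :=
  [set [set K | conjugated H K] | H in single_object_subgroupoids G].
Arguments conjugacy_classes : clear implicits.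

Definition strongly_finite (G : groupoid) : Prop :=
  finite_set [set: arr G].

Definition locally_strongly_finite (G : groupoid) : Prop :=
  finite_set (conjugacy_classes G) /\
  forall x : obj G, finite_set (isotropy x).

(* As for composition, [act x g] is only meaningful when [str x = tgt g]. *)
Record gset (G : groupoid) := GSet {
  carrier :> Type;
  str : carrier -> obj G;
  act : carrier -> arr G -> carrier;
  str_act : forall x g, str x = tgt g -> str (act x g) = src g;
  act1 : forall x, act x (gid (str x)) = x;
  actA : forall x g h, str x = tgt g -> src g = tgt h ->
    act (act x g) h = act x (gcomp g h)
}.

Definition finite_gset (G : groupoid) (X : gset G) : Prop :=
  finite_set [set: X].

Definition gset_morphism (G : groupoid) (X Y : gset G) (f : X -> Y) : Prop :=
  (forall x, str (f x) = str x) /\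
  (forall x g, str x = tgt g -> f (act x g) = act (f x) g).

Definition gset_isomorphic (G : groupoid) (X Y : gset G) : Prop :=
  exists (f : X -> Y) (f' : Y -> X),
    [/\ gset_morphism f, gset_morphism f', cancel f f' & cancel f' f].

(* Fixed points under H, when H has the single object a. *)
Definition fixed_points (G : groupoid) (X : gset G) (H : subgroupoid G)
    (a : obj G) : set X :=
  [set x | str x = a /\ forall h, sarr H h -> act x h = x].
Arguments fixed_points {G} X H a.

(* Main.v *)
Require Import Defs.
From mathcomp Require Import all_boot finmap.
From mathcomp Require Import boolp classical_sets functions cardinality.

(** Isomorphic G-sets have fixed-point sets of equal size because an
    equivariant bijection preserves the object below a point and the arrows
    that fix it, so it restricts to the points fixed by any H.

    For the converse, isomorphisms are built orbit by orbit, as relations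
    between stable subsets A of X and B of Y whose fixed-point sets match
    ([exists_equivariant_correspondence]).  Say that x' dominates x when x' is
    fixed by the stabiliser of x; for points of X this is a preorder.  Since A
    is finite, it has a point x that is maximal for it.  The stabiliser H of x
    fixes x, so it fixes a point of A, so it fixes some y in B; in turn the
    stabiliser of y fixes y, so it fixes some x' in A.  Then x' dominates x,
    hence x dominates x' by maximality, and as x' dominates y it follows that x
    and y have the same stabiliser.  Therefore x g |-> y g is a well-defined
    equivariant bijection between the orbits of x and y.  By the easy direction
    these two orbits have equally many points fixed by every subgroupoid.
    Removing them from A and B leaves stable subsets to which the same argument
    applies, since equal finite cardinals can be cancelled; this terminates as A
    is finite.  If A is empty then B is empty too: a point y in B is fixed by
    its own stabiliser, which would then fix a point of A.

    A strongly finite groupoid is locally strongly finite because a subgroupoid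
    is determined by its set of arrows, and a finite set has finitely many
    subsets. *)

Set Implicit Arguments.
Unset Strict Implicit.
Unset Printing Implicit Defensive.

Local Open Scope classical_set_scope.
Local Open Scope card_scope.

(** * Finite sets over arbitrary types *)

Lemma properset_ind_choice (T : choiceType) (P : set T -> Prop) :
  (forall A, finite_set A -> (forall B, B `<` A -> P B) -> P A) ->
  forall A, finite_set A -> P A.
Proof.
move=> IH A finA; have [n] := ubnP #|` fset_set A|.
elim: n => // n IHn in A finA *; rewrite ltnS => leAn.
apply: IH => // B [subBA nsubAB].
have finB : finite_set B by apply: sub_finite_set finA.
apply: IHn => //; apply: leq_trans leAn; apply: fproper_ltn_card.
rewrite fproperE; apply/andP; split; first by rewrite -fset_set_sub.
by apply/negP; rewrite -fset_set_sub.
Qed.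

Lemma properset_ind (T : Type) (P : set T -> Prop) :
  (forall A, finite_set A -> (forall B, B `<` A -> P B) -> P A) ->
  forall A, finite_set A -> P A.
Proof. exact: (@properset_ind_choice {classic T}). Qed.

Lemma card_eq_setD_choice (T U : choiceType) (A C : set T) (B D : set U) :
  finite_set A -> C `<=` A -> D `<=` B -> A #= B -> C #= D ->
  A `\` C #= B `\` D.
Proof.
move=> finA subCA subDB eqAB eqCD.
have finB : finite_set B by rewrite -(eq_finite_set eqAB).
have finC := sub_finite_set subCA finA.
have finD := sub_finite_set subDB finB.
apply/fcard_eq; [exact: finite_setD..|].
rewrite !fset_setD // !cardfsDS; [|by rewrite -fset_set_sub..].
by congr subn; apply/fcard_eq.
Qed.

Lemma card_eq_setD (T U : Type) (A C : set T) (B D : set U) :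
  finite_set A -> C `<=` A -> D `<=` B -> A #= B -> C #= D ->
  A `\` C #= B `\` D.
Proof. exact: (@card_eq_setD_choice {classic T} {classic U}). Qed.

Lemma finite_powerset_choice (T : choiceType) (A : set T) :
  finite_set A -> finite_set [set B | B `<=` A].
Proof.
move=> finA.
apply: (@sub_finite_set _ _
  [set [set` Y] | Y in [set` fpowerset (fset_set A)]]).
  move=> B /= subBA; have finB := sub_finite_set subBA finA.
  exists (fset_set B); last by rewrite fset_setK.
  by rewrite /= fpowersetE -fset_set_sub.
exact: finite_image.
Qed.

Lemma finite_powerset (T : Type) (A : set T) :
  finite_set A -> finite_set [set B | B `<=` A].
Proof. exact: (@finite_powerset_choice {classic T}). Qed.

(** If [a] is not maximal itself, a maximal element among those strictly above
    [a] is maximal in the whole of [A]. *)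
Lemma finite_set_maximal (T : Type) (r : T -> T -> Prop) (A : set T) :
  (forall x, r x x) -> (forall x y z, r x y -> r y z -> r x z) ->
  finite_set A -> A !=set0 ->
  exists2 m, A m & forall y, A y -> r m y -> r y m.
Proof.
move=> refl_r trans_r; elim/properset_ind => {}A finA IH [a Aa].
have [amax|/existsNP[b /not_implyP[Ab /not_implyP[rab nrba]]]] :=
  pselect (forall y, A y -> r a y -> r y a); first by exists a.
have [||m [Am ram nrma] mmax] := IH [set z | [/\ A z, r a z & ~ r z a]].
- split=> [z []//|/(_ a Aa)[_ _]]; exact.
- by exists b.
exists m => // y Ay rmy; have [rya|nrya] := pselect (r y a).
  exact: trans_r ram.
by apply: mmax => //; split=> //; apply: trans_r rmy.
Qed.

(** * One-to-one correspondences *)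

(** The graph of a bijection from [A] to [B].  Graphs are used rather than
    functions because disjoint ones are glued by taking their union. *)
Definition correspondence (T U : Type) (A : set T) (B : set U)
    (R : T -> U -> Prop) : Prop :=
  [/\ forall x y, R x y -> A x /\ B y,
      forall x, A x -> exists y, R x y,
      forall y, B y -> exists x, R x y &
      forall x y x' y', R x y -> R x' y' -> (x = x' <-> y = y')].

Lemma correspondence_sym (T U : Type) (A : set T) (B : set U) R :
  correspondence A B R -> correspondence B A (fun y x => R x y).
Proof.
case=> RAB RA RB R11; split=> // [y x /RAB[]//|y x y' x' Rxy Rxy'].
by apply: iff_sym; apply: R11.
Qed.

Lemma correspondenceU (T U : Type) (A C : set T) (B D : set U) R S :
  (forall x, A x -> C x -> False) -> (forall y, B y -> D y -> False) ->
  correspondence A B R -> correspondence C D S ->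
  correspondence (A `|` C) (B `|` D) (fun x y => R x y \/ S x y).
Proof.
move=> disAC disBD [RAB RA RB R11] [SCD SC SD S11]; split.
- by move=> x y [/RAB|/SCD] []; split; by [left|right].
- by move=> x [/RA|/SC] [y]; exists y; by [left|right].
- by move=> y [/RB|/SD] [x]; exists x; by [left|right].
move=> x y x' y' [Rxy|Sxy] [Rxy'|Sxy']; [exact: R11| | |exact: S11].
- have [[Ax By] [Cx Dy]] := (RAB _ _ Rxy, SCD _ _ Sxy').
  by split=> E; subst; [case: (disAC x')|case: (disBD y')].
- have [[Ax By] [Cx Dy]] := (RAB _ _ Rxy', SCD _ _ Sxy).
  by split=> E; subst; [case: (disAC x')|case: (disBD y')].
Qed.

Lemma correspondence_card_le (T U : Type) (A : set T) (B : set U) R :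
  correspondence A B R -> A #<= B.
Proof.
case=> RAB RA _ R11; have [B0|/set0P[b _]] := eqVneq B set0.
  suff -> : A = set0 by rewrite card_ge0.
  by rewrite -subset0 => x /RA[y /RAB[_]]; rewrite B0.
(* outside of A the chosen function may take the junk value b *)
have /choice[f fR] x : exists y, A x -> R x y.
  by have [/RA[y]|nAx] := pselect (A x); [exists y|exists b].
have -> : (A #<= B) = (f @` A #<= B).
  apply/esym/card_le_eql/inj_card_eq => x x' /set_mem/fR Rx /set_mem/fR Rx' E.
  by apply/(R11 _ _ _ _ Rx Rx').
by apply: subset_card_le => _ [x /fR/RAB[_ Bfx] <-].
Qed.

Lemma correspondence_card_eq (T U : Type) (A : set T) (B : set U) R :
  correspondence A B R -> A #= B.
Proof.
move=> cR; rewrite card_eq_le (correspondence_card_le cR).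
exact: correspondence_card_le (correspondence_sym cR).
Qed.

(** * Orbits and stabilisers *)

Definition equivariant (G : groupoid) (X Y : gset G) (R : X -> Y -> Prop) :=
  forall x y, R x y -> str x = str y /\
    forall g, str x = tgt g -> R (act x g) (act y g).

Definition stable (G : groupoid) (X : gset G) (A : set X) :=
  forall x g, str x = tgt g -> A x -> A (act x g).

Definition orbit (G : groupoid) (X : gset G) (x : X) : set X :=
  [set act x g | g in [set g | str x = tgt g]].

Lemma orbit_refl (G : groupoid) (X : gset G) (x : X) : orbit x x.
Proof. by exists (gid (str x)); rewrite /= ?tgt_gid ?act1. Qed.

Lemma actK (G : groupoid) (X : gset G) (x : X) g :
  str x = tgt g -> act (act x g) (ginv g) = x.
Proof.
by move=> xg; rewrite actA ?tgt_ginv // gcompgV -xg act1.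
Qed.

Lemma stable_setD_orbit (G : groupoid) (X : gset G) (A : set X) (x : X) :
  stable A -> stable (A `\` orbit x).
Proof.
move=> stA u g ug [Au nOu]; split=> [|[h xh E]]; first exact: stA.
have sgh : src h = src g by rewrite -(str_act xh) E str_act.
apply: nOu; exists (gcomp h (ginv g)).
  by rewrite /= tgt_gcomp // tgt_ginv.
by rewrite -actA ?tgt_ginv // E actK.
Qed.

Lemma orbit_sub_stable (G : groupoid) (X : gset G) (A : set X) (x : X) :
  stable A -> A x -> orbit x `<=` A.
Proof. by move=> stA Ax _ [g xg <-]; apply: stA. Qed.

Definition stabiliser (G : groupoid) (X : gset G) (x : X) : subgroupoid G.
Proof.
apply: (@Subgroupoid G [set str x]
  [set g | hom (str x) (str x) g /\ act x g = x]) => /=.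
- by exists (str x).
- by move=> g [[]].
- by move=> g [[]].
- by move=> a ->; split; [split; [exact: src_gid|exact: tgt_gid]|exact: act1].
- move=> g h [[sg tg] xg] [[sh th] xh] gh; split.
    by split; rewrite ?src_gcomp ?tgt_gcomp.
  by rewrite -actA // xg.
- move=> g [[sg tg] xg]; split; first by split; rewrite ?src_ginv ?tgt_ginv.
  by rewrite -[in LHS]xg actK.
Defined.

Lemma stabiliser_single_object (G : groupoid) (X : gset G) (x : X) :
  has_single_object (stabiliser x) (str x).
Proof. by []. Qed.

(** Inclusion of the stabiliser of [x] in that of [y], phrased through fixed
    points so that equal fixed-point counts apply to it directly. *)
Notation fixed_by_stabiliser x y :=
  (fixed_points _ (stabiliser x) (str x) y).

Lemma fixed_by_stabiliser_refl (G : groupoid) (X : gset G) (x : X) :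
  fixed_by_stabiliser x x.
Proof. by split=> // h []. Qed.

Lemma fixed_by_stabiliser_trans (G : groupoid) (X Y Z : gset G)
    (x : X) (y : Y) (z : Z) :
  fixed_by_stabiliser x y -> fixed_by_stabiliser y z ->
  fixed_by_stabiliser x z.
Proof.
move=> [exy fixy] [eyz fixz]; split; first by rewrite eyz.
by move=> h [xh fixx]; apply: fixz; split; [rewrite exy|apply: fixy].
Qed.

(** Whether [x g = x h] only depends on whether [g h^-1] stabilises [x]. *)
Lemma act_eq_fixed_by_stabiliser (G : groupoid) (X Y : gset G)
    (x : X) (y : Y) g h :
  fixed_by_stabiliser x y -> str x = tgt g -> str x = tgt h ->
  act x g = act x h -> act y g = act y h.
Proof.
move=> [exy fixy] xg xh E.
have sgh : src g = src h by rewrite -(str_act xg) E str_act.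
have gVh : src g = tgt (ginv h) by rewrite tgt_ginv.
have /fixy fixgh : sarr (stabiliser x) (gcomp g (ginv h)).
  split; first by split; rewrite ?src_gcomp ?tgt_gcomp // src_ginv.
  by rewrite -actA // E actK.
rewrite -[in RHS]fixgh -actA ?exy // actA ?str_act ?exy ?src_ginv ?tgt_ginv //.
by rewrite gcompVg -sgh -(@str_act _ _ y) ?exy // act1.
Qed.

Definition orbit_graph (G : groupoid) (X Y : gset G) (x : X) (y : Y) u v :=
  exists g, [/\ str x = tgt g, u = act x g & v = act y g].

(** The inclusion of the stabiliser of [x] in that of [y] makes [x g |-> y g]
    well defined; the reverse inclusion makes it injective. *)
Lemma orbit_graph_correspondence (G : groupoid) (X Y : gset G)
    (x : X) (y : Y) :
  fixed_by_stabiliser x y -> fixed_by_stabiliser y x ->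
  correspondence (orbit x) (orbit y) (orbit_graph x y).
Proof.
move=> xy yx; have exy : str y = str x by case: xy.
split.
- by move=> _ _ [g [xg -> ->]]; split; exists g => //=; rewrite exy.
- by move=> _ [g xg <-]; exists (act y g), g.
- by move=> _ [g yg <-]; exists (act x g), g; rewrite -exy.
move=> _ _ _ _ [g [xg -> ->]] [h [xh -> ->]].
by split; apply: act_eq_fixed_by_stabiliser => //; rewrite exy.
Qed.

Lemma orbit_graph_equivariant (G : groupoid) (X Y : gset G) (x : X) (y : Y) :
  str y = str x -> equivariant (orbit_graph x y).
Proof.
move=> exy _ _ [g [xg -> ->]]; rewrite !str_act ?exy //; split=> // h gh.
by exists (gcomp g h); rewrite tgt_gcomp ?actA ?exy.
Qed.

(** * Fixed points and isomorphisms *)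

(** An arrow [h] fixes [x] exactly when it fixes the point [y] corresponding to
    [x], because [x h] corresponds to [y h]. *)
Lemma correspondence_fixed_points (G : groupoid) (X Y : gset G)
    (A : set X) (B : set Y) R (H : subgroupoid G) (a : obj G) :
  correspondence A B R -> equivariant R -> has_single_object H a ->
  A `&` fixed_points X H a #= B `&` fixed_points Y H a.
Proof.
move=> [RAB RA RB R11] eqR Ha.
have fixR x y : R x y -> fixed_points X H a x <-> fixed_points Y H a y.
  move=> /[dup] Rxy /eqR[exy Rxyg].
  have fixh h : str x = a -> sarr H h -> (act x h = x <-> act y h = y).
    move=> xa /sarr_tgt; rewrite Ha => th; apply: R11 => //.
    by apply: Rxyg; rewrite xa th.
  split=> -[ea fx]; split; rewrite ?exy -?ea // => h Hh.
  - by apply/(fixh h) => //; apply: fx.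
  - by apply/(fixh h); rewrite ?exy //; apply: fx.
apply: (@correspondence_card_eq _ _ _ _
  (fun x y => R x y /\ fixed_points X H a x)).
split.
- by move=> x y [Rxy Fx]; have [Ax By] := RAB _ _ Rxy; do 2!split=> //;
    apply/(fixR _ _ Rxy).
- by move=> x [/RA[y Rxy] Fx]; exists y.
- by move=> y [/RB[x Rxy] Fy]; exists x; split=> //; apply/(fixR _ _ Rxy).
by move=> x y x' y' [Rxy _] [Rxy' _]; apply: R11.
Qed.

Lemma correspondence_isomorphic (G : groupoid) (X Y : gset G) R :
  correspondence [set: X] [set: Y] R -> equivariant R -> gset_isomorphic X Y.
Proof.
move=> [_ RX RY R11] eqR.
have /choice[f fR] x : exists y, R x y by apply: RX.
have /choice[f' f'R] y : exists x, R x y by apply: RY.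
exists f, f'; split.
- split=> x; first by have [] := eqR _ _ (fR x).
  move=> g xg; have [_ /(_ g xg) Rg] := eqR _ _ (fR x).
  by have [->] := R11 _ _ _ _ (fR (act x g)) Rg.
- split=> y; first by have [] := eqR _ _ (f'R y).
  have [exy Rg] := eqR _ _ (f'R y).
  move=> g yg; have {}Rg := Rg g (etrans exy yg).
  by have [_ ->] := R11 _ _ _ _ (f'R (act y g)) Rg.
- by move=> x; have [_ ->] := R11 _ _ _ _ (f'R (f x)) (fR x).
- by move=> y; have [->] := R11 _ _ _ _ (fR (f' y)) (f'R y).
Qed.

Lemma isomorphic_correspondence (G : groupoid) (X Y : gset G) :
  gset_isomorphic X Y ->
  exists2 R, correspondence [set: X] [set: Y] R & equivariant R.
Proof.
move=> [f [f' [[sf af] _ fK f'K]]]; exists (fun x y => f x = y).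
  split=> // [x _|y _|x _ x' _ <- <-]; first by exists (f x).
    by exists (f' y).
  by split=> [->//|]; apply: can_inj fK _ _.
by move=> x _ <-; split=> [|g xg]; [rewrite sf|apply: af].
Qed.

(** Stable subsets instead of whole G-sets keep the induction inside [X] and
    [Y]: no G-set structure has to be put on what remains after an orbit is
    removed.  The induction is on [A]; the matching fixed points force [B] to
    be exhausted at the same time. *)
Lemma exists_equivariant_correspondence (G : groupoid) (X Y : gset G)
    (A : set X) (B : set Y) :
  finite_set A -> stable A -> stable B ->
  (forall (H : subgroupoid G) (a : obj G), has_single_object H a ->
     A `&` fixed_points X H a #= B `&` fixed_points Y H a) ->
  exists2 R, correspondence A B R & equivariant R.
Proof.
move=> finA; elim/properset_ind: finA B => {}A finA IH B stA stB eqAB.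
have fixAB (x : X) : A x -> exists2 y, B y & fixed_by_stabiliser x y.
  move=> Ax; have := eqAB _ _ (stabiliser_single_object x).
  have [->|/set0P[y [By Fy]] _] :=
    eqVneq (B `&` fixed_points Y (stabiliser x) (str x)) set0; last by exists y.
  rewrite card_eq0 => /eqP/seteqP[/(_ x) + _].
  by case; split=> //; apply: fixed_by_stabiliser_refl.
have fixBA (y : Y) : B y -> exists2 x, A x & fixed_by_stabiliser y x.
  move=> By; have := card_esym (eqAB _ _ (stabiliser_single_object y)).
  have [->|/set0P[x [Ax Fx]] _] :=
    eqVneq (A `&` fixed_points X (stabiliser y) (str y)) set0; last by exists x.
  rewrite card_eq0 => /eqP/seteqP[/(_ y) + _].
  by case; split=> //; apply: fixed_by_stabiliser_refl.
have [A0|/set0P neA] := eqVneq A set0.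
  have noA x : ~ A x by rewrite A0.
  exists (fun _ _ => False) => //.
  by split=> // [x /noA|y /fixBA[x /noA]].
have [x Ax xmax] := finite_set_maximal (r := fun x x' : X =>
    fixed_by_stabiliser x x') (@fixed_by_stabiliser_refl G X)
    (@fixed_by_stabiliser_trans G X X X) finA neA.
have [y By xy] := fixAB x Ax; have [x' Ax' yx'] := fixBA y By.
have yx : fixed_by_stabiliser y x.
  apply: (fixed_by_stabiliser_trans yx'); apply: xmax => //.
  exact: fixed_by_stabiliser_trans yx'.
have corO := orbit_graph_correspondence xy yx.
have eqO : equivariant (orbit_graph x y).
  by apply: orbit_graph_equivariant; case: xy.
have subOA := orbit_sub_stable stA Ax.
have subOB := orbit_sub_stable stB By.
have [||||R corR eqR] := IH (A `\` orbit x) _ (B `\` orbit y).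
- split=> [u []//|/(_ x Ax)[_]]; apply; exact: orbit_refl.
- exact: stable_setD_orbit.
- exact: stable_setD_orbit.
- move=> H a Ha; rewrite !setIDAC !setIDA.
  have -> : (A `&` fixed_points X H a) `\` orbit x =
      (A `&` fixed_points X H a) `\` (orbit x `&` fixed_points X H a).
    by rewrite setDIr; apply/esym/setUidl => u [[_ Fu]].
  have -> : (B `&` fixed_points Y H a) `\` orbit y =
      (B `&` fixed_points Y H a) `\` (orbit y `&` fixed_points Y H a).
    by rewrite setDIr; apply/esym/setUidl => u [[_ Fu]].
  apply: card_eq_setD; [exact: finite_setIl|exact: setSI|exact: setSI| |].
    exact: eqAB.
  exact: correspondence_fixed_points corO eqO Ha.
exists (fun u v => orbit_graph x y u v \/ R u v).
  rewrite -(setDUK subOA) -(setDUK subOB).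
  by apply: correspondenceU => // u Ou [].
by move=> u v [/eqO|/eqR] [euv Ruv]; split=> // g /Ruv; by [left|right].
Qed.

Lemma isomorphic_iff_fixed_points (G : groupoid) (X Y : gset G) :
  finite_gset X ->
  gset_isomorphic X Y <->
  forall (H : subgroupoid G) (a : obj G), has_single_object H a ->
    fixed_points X H a #= fixed_points Y H a.
Proof.
move=> finX; split=> [/isomorphic_correspondence[R corR eqR] H a Ha|eqXY].
  by have := correspondence_fixed_points corR eqR Ha; rewrite !setTI.
have [//|//|H a Ha|R corR eqR] :=
  @exists_equivariant_correspondence G X Y setT setT finX.
  by rewrite !setTI; apply: eqXY.
exact: correspondence_isomorphic corR eqR.
Qed.

(** * Strongly finite groupoids *)

(** The objects of a subgroupoid are recovered as the sources of its arrows,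
    since it contains the identities of its objects. *)
Lemma sarr_inj (G : groupoid) : injective (@sarr G).
Proof.
have sobjE (H : subgroupoid G) : sobj H = [set src g | g in sarr H].
  apply/seteqP; split=> [a Ha|_ [g Hg <-]]; last exact: sarr_src.
  by exists (gid a); [exact: sarr_gid|exact: src_gid].
move=> H K E; have Eo : sobj H = sobj K by rewrite !sobjE E.
case: H K E Eo => [o s p1 p2 p3 p4 p5 p6] [o' s' q1 q2 q3 q4 q5 q6] /= E Eo.
subst; congr Subgroupoid; exact: Prop_irrelevance.
Qed.

Lemma strongly_finite_locally (G : groupoid) :
  strongly_finite G -> locally_strongly_finite G.
Proof.
move=> finG; split; last by move=> x; apply: sub_finite_set finG.
apply: finite_image.
apply: (@sub_finite_set _ _ (@sarr G @^-1` [set B | B `<=` setT])) => //.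
by apply: finite_preimage (finite_powerset finG) => H K _ _; apply: sarr_inj.
Qed.

Theorem theoremB (G : groupoid) :
  (locally_strongly_finite G ->
    forall X Y : gset G, finite_gset X -> finite_gset Y ->
      (gset_isomorphic X Y <->
       forall (H : subgroupoid G) (a : obj G), has_single_object H a ->
         (fixed_points X H a #= fixed_points Y H a)%card)) /\
  (strongly_finite G ->
    locally_strongly_finite G /\
    forall X Y : gset G, finite_gset X -> finite_gset Y ->
      (gset_isomorphic X Y <->
       forall (H : subgroupoid G) (a : obj G), has_single_object H a ->
         (fixed_points X H a #= fixed_points Y H a)%card)).
Proof.
split=> [_ X Y finX _|finG]; first exact: isomorphic_iff_fixed_points.
split; first exact: strongly_finite_locally.
by move=> X Y finX _; apply: isomorphic_iff_fixed_points.
Qed.
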